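(* Let $G$ be a finite group such that, for every prime $q$ dividing $|G|$, the Sylow $q$-subgroup of $G$ is unique, and let $K$ be a finite field of characteristic $p$. If the group algebra $KG$ contains an LCD group code $C$ which is also an MDS code, then $p\nmid |G|$.
   Context: For a finite field $K$ and a finite group $G$, $KG=\{\sum_{g\in G}a_g g : a_g\in K\}$ is the group algebra with its usual addition and multiplication. A group code is a right ideal $C$ of $KG$, viewed as a linear code of length $n=|G|$ over $K$ with weight $wt(a)=|\{g\in G: a_g\neq 0\}|$. The minimum distance $d(C)$ is the minimum weight of a nonzero element of $C$. The inner product on $KG$ is $\langle a,b\rangle=\sum_{g\in G}a_g b_g$, and $C^\perp=\{b\in KG:\langle a,b\rangle=0\ \forall a\in C\}$. $C$ is LCD (linear complementary dual) if $C\cap C^\perp=\{0\}$. $C$ is MDS (maximum distance separable) if $d(C)=n-\dim_K(C)+1$.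
   Formalization: The code C is additionally assumed to be different from KG: the whole algebra KG is always an LCD group code and MDS (d = 1), so the claim fails as printed, e.g. for G of order 2 and K = F_2. *)

(* Defs.v *)
From HB Require Import structures.
From mathcomp Require Import all_boot all_order all_algebra.
From mathcomp Require Import all_fingroup all_solvable.

Set Implicit Arguments.
Unset Strict Implicit.
Unset Printing Implicit Defensive.

Import GRing.Theory.
Local Open Scope ring_scope.

(* KG as the K-space of coefficient functions g |-> a_g.  This is an alias     *)
(* because {ffun G -> K} already carries the pointwise product; the group      *)
(* algebra has the convolution product.  The codomain is K^o only so that the  *)
(* vectType K structure of {ffun _ -> _} applies.                              *)
Definition group_algebra (K : fieldType) (G : finGroupType) : Type :=
  {ffun G -> K^o}.

HB.instance Definition _ (K : fieldType) (G : finGroupType) :=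
  Vector.copy (group_algebra K G) {ffun G -> K^o}.

Section GroupAlgebra.

Variables (K : fieldType) (G : finGroupType).
Local Notation KG := (group_algebra K G).
Implicit Types (a b c : KG) (g h : G).

Definition coef a g : K := (a : {ffun G -> K^o}) g.

Definition ga_elem g : KG := [ffun h => (h == g)%:R : K^o].

(* (sum_h a_h h) (sum_k b_k k) has coefficient sum_(h k = g) a_h b_k at g. *)
Definition ga_mul a b : KG :=
  [ffun g => \sum_h coef a h * coef b (h^-1 * g)%g : K^o].

Lemma ga_eqP a b : (forall g, coef a g = coef b g) <-> a = b.
Proof. by split=> [eq_ab | -> //]; apply/ffunP. Qed.

Lemma coefD a b g : coef (a + b) g = coef a g + coef b g.
Proof. by rewrite /coef ffunE. Qed.

Lemma coefZ k a g : coef (k *: a) g = k * coef a g.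
Proof. by rewrite /coef ffunE. Qed.

Lemma coef_elem g h : coef (ga_elem g) h = (h == g)%:R.
Proof. by rewrite /coef ffunE. Qed.

Lemma coef_mul a b g :
  coef (ga_mul a b) g = \sum_h coef a h * coef b (h^-1 * g)%g.
Proof. by rewrite {1}/coef ffunE. Qed.

Fact ga_mulA : associative ga_mul.
Proof.
move=> a b c; apply/ga_eqP=> g; rewrite !coef_mul.
under eq_bigr => h _ do rewrite coef_mul big_distrr /=.
under [RHS]eq_bigr => k _ do rewrite coef_mul big_distrl /=.
rewrite [RHS]exchange_big /=; apply: eq_bigr => h _.
rewrite (reindex_inj (mulgI h^-1%g)) /=; apply: eq_bigr => k _.
by rewrite mulrA invMg invgK -mulgA mulKVg.
Qed.

Fact ga_mul1r : left_id (ga_elem 1%g) ga_mul.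
Proof.
move=> a; apply/ga_eqP=> g; rewrite coef_mul (bigD1 1%g) //= big1 => [|h h1].
  by rewrite coef_elem eqxx mul1r invg1 mul1g addr0.
by rewrite coef_elem (negPf h1) mul0r.
Qed.

Fact ga_mulr1 : right_id (ga_elem 1%g) ga_mul.
Proof.
move=> a; apply/ga_eqP=> g; rewrite coef_mul (bigD1 g) //= big1 => [|h hg].
  by rewrite coef_elem mulVg eqxx mulr1 addr0.
by rewrite coef_elem -eq_invg_mul invgK (negPf hg) mulr0.
Qed.

Fact ga_mulrDl : left_distributive ga_mul +%R.
Proof.
move=> a b c; apply/ga_eqP=> g; rewrite coefD !coef_mul -big_split /=.
by apply: eq_bigr => h _; rewrite coefD mulrDl.
Qed.

Fact ga_mulrDr : right_distributive ga_mul +%R.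
Proof.
move=> a b c; apply/ga_eqP=> g; rewrite coefD !coef_mul -big_split /=.
by apply: eq_bigr => h _; rewrite coefD mulrDr.
Qed.

Fact ga_oner_neq0 : ga_elem 1%g != 0.
Proof.
apply/eqP=> /ga_eqP/(_ 1%g); rewrite coef_elem eqxx /coef ffunE.
by move/eqP; rewrite oner_eq0.
Qed.

HB.instance Definition _ := GRing.Zmodule_isNzRing.Build KG
  ga_mulA ga_mul1r ga_mulr1 ga_mulrDl ga_mulrDr ga_oner_neq0.

Fact ga_scalerAl (k : K) a b : k *: (a * b) = (k *: a) * b.
Proof.
apply/ga_eqP=> g; rewrite coefZ !coef_mul big_distrr /=.
by apply: eq_bigr => h _; rewrite coefZ mulrA.
Qed.

HB.instance Definition _ := GRing.Lmodule_isLalgebra.Build K KG ga_scalerAl.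

Fact ga_scalerAr (k : K) a b : k *: (a * b) = a * (k *: b).
Proof.
apply/ga_eqP=> g; rewrite coefZ !coef_mul big_distrr /=.
by apply: eq_bigr => h _; rewrite coefZ mulrCA.
Qed.

HB.instance Definition _ := GRing.Lalgebra_isAlgebra.Build K KG ga_scalerAr.

Lemma ga_elemM g h : ga_elem g * ga_elem h = ga_elem (g * h)%g.
Proof.
apply/ga_eqP=> k; rewrite coef_mul (bigD1 g) //= big1 => [|l lg].
  by rewrite !coef_elem eqxx mul1r addr0 -(inj_eq (mulgI g)) mulKVg.
by rewrite coef_elem (negPf lg) mul0r.
Qed.

Definition wt a : nat := #|[set g | coef a g != 0]|.

Definition inner a b : K := \sum_g coef a g * coef b g.

(* Right ideals of KG are K-subspaces, since KG contains the scalars. *)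
Definition group_code (C : {vspace KG}) : Prop :=
  forall a b, a \in C -> a * b \in C.

Definition in_dual (C : {vspace KG}) b : Prop :=
  forall a, a \in C -> inner a b = 0.

Definition LCD (C : {vspace KG}) : Prop :=
  forall b, (b \in C /\ in_dual C b) <-> b = 0.

(* The zero code has no minimum distance, hence is not MDS. *)
Definition is_min_dist (C : {vspace KG}) (d : nat) : Prop :=
  (exists a, [/\ a \in C, a != 0 & wt a = d]) /\
  (forall a, a \in C -> a != 0 -> (d <= wt a)%N).

(* The subtraction does not truncate, as \dim C <= \dim {:KG} = #|G|. *)
Definition MDS (C : {vspace KG}) : Prop :=
  is_min_dist C (#|G| - \dim C + 1)%N.

End GroupAlgebra.

(* Main.v *)
From HB Require Import structures.
Require Import Defs.
From mathcomp Require Import all_boot all_order all_algebra.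
From mathcomp Require Import all_fingroup all_solvable all_field.
From mathcomp Require Import mxrepresentation mxabelem.
From mathcomp Require Import zify.

(** Let n = |G|, let k be the dimension of C, and suppose that p divides n.

    The hypothesis on Sylow subgroups says that G is nilpotent; in particular
    p divides the order of the centre of G.  As C is LCD, KG is the orthogonal
    direct sum of C and its dual, so the projection E onto C along the dual is
    a symmetric idempotent matrix of rank k; as C is a right ideal, E commutes
    with right multiplications ([code_proj_comm]).  As C is MDS, any k
    coordinates form an information set, i.e., restricting C to k coordinates
    loses no rank ([mds_info_set]).  Both facts survive the extension of K to
    an algebraically closed field F, where the rest takes place.

    Let Q be a subgroup of order prime to p, lam a linear character of Q, and
    e the corresponding idempotent of FQ.  The rank of E e is the multiplicity
    c of lam in the restriction of C to Q.  Two constraints bear on it.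
    - Restricting C to a union of left cosets of Q, which is a free FQ-module,
      squeezes c between the floor and the ceiling of k / |Q|
      ([rank_lin_idem_ge], [rank_lin_idem_le]).
    - The trace of E times right multiplication by x is a sum over G of a
      function invariant under translation by the centre, so it is 0; hence
      c, the rank and thus the trace of an idempotent, is 0 in F, that is,
      p divides c ([dvdn_rank_lin_idem]).
    Floor and ceiling differ by at most 1, so c is the same for all linear
    characters of Q ([rank_lin_idem_const]).

    If M is normal of prime index q in Q, then the fixed points of M in C
    decompose under the q linear characters of Q / M, which therefore all occur
    equally often; climbing a subnormal series of a solvable Q this way gives
    dim C^Q = k / |Q| ([rank_fixed_mul]).

    Take for Q the p-complement H of G.  As 0 < k < n, both E and 1 - E leave
    nonzero H-fixed vectors.  The p-group G / H acts on these in
    characteristic p, so it fixes a nonzero vector in each of the two spaces.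
    But the vectors of FG fixed by G form a line, the constant vectors, which
    would lie in the images of both E and 1 - E: a contradiction
    ([no_mds_idempotent]). *)

Set Implicit Arguments.
Unset Strict Implicit.
Unset Printing Implicit Defensive.

Import GRing.Theory.
Local Open Scope group_scope.
Local Open Scope ring_scope.

(** * Idempotent matrices *)

Section Idempotents.

Variables (F : fieldType) (n : nat).
Implicit Types (A B E : 'M[F]_n) (S T : {set 'I_n}).

(** In the rank factorization E = C R, idempotence forces R C = 1, and the trace
    is invariant under exchanging the two factors. *)
Lemma mxtrace_idem E : E *m E = E -> \tr E = (\rank E)%:R.
Proof.
move=> idE; rewrite -{1}[E]mulmx_base mxtrace_mulC.
suff -> : row_base E *m col_base E = 1%:M by rewrite mxtrace1.
have cfree : row_free (col_base E)^T.
  by rewrite /row_free mxrank_tr; apply: col_base_full.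
apply: (row_free_inj (row_base_free E)); rewrite mul1mx.
apply: trmx_inj; apply: (row_free_inj cfree); rewrite -!trmx_mul.
by rewrite -mulmxA mulmx_base mulmxA mulmx_base idE.
Qed.

Lemma mxrank_idemD A B : A *m A = A -> B *m B = B ->
  A *m B = 0 -> B *m A = 0 -> \rank (A + B)%R = (\rank A + \rank B)%N.
Proof.
move=> idA idB AB0 BA0; rewrite -mxrank_disjoint_sum; last first.
  apply/eqP/rowV0P=> u; rewrite sub_capmx => /andP[/submxP[v ->]] /submxP[w].
  by move=> uw; rewrite -idA mulmxA uw -mulmxA BA0 mulmx0.
apply: eqmx_rank; apply/andP; split; first exact: addmx_sub_adds.
have sA : A = A *m (A + B) by rewrite mulmxDr idA AB0 addr0.
have sB : B = B *m (A + B) by rewrite mulmxDr idB BA0 add0r.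
rewrite addsmx_sub; apply/andP.
by split; [rewrite {1}sA | rewrite {1}sB]; apply: submxMl.
Qed.

Lemma mxrank_idem_sum m (e : 'I_m -> 'M[F]_n) :
    (forall i, e i *m e i = e i) ->
    (forall i j, i != j -> e i *m e j = 0) ->
  \rank (\sum_i e i)%R = (\sum_i \rank (e i))%N.
Proof.
elim: m e => [|m IHm] e ide oe; first by rewrite !big_ord0 mxrank0.
have lift0 i j : (lift ord0 i == lift ord0 j) = (i == j :> 'I_m).
  exact: (inj_eq lift_inj).
have oS i j : i != j -> e (lift ord0 i) *m e (lift ord0 j) = 0.
  by move=> ij; rewrite oe ?lift0.
rewrite !big_ord_recl mxrank_idemD ?IHm ?ide //.
- rewrite mulmx_suml; apply: eq_bigr => i _.
  rewrite mulmx_sumr (bigD1 i) //= ide big1 ?addr0 // => j ji.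
  by rewrite oS // eq_sym.
- by rewrite mulmx_sumr big1 // => i _; rewrite oe // neq_lift.
- by rewrite mulmx_suml big1 // => i _; rewrite oe // eq_sym neq_lift.
Qed.

(** Right multiplication by this matrix keeps the coordinates in T and sets the
    others to 0, so the rank of [A *m proj_on T] is that of the restriction to T
    of the code spanned by the rows of A. *)
Definition proj_on (T : {set 'I_n}) : 'M[F]_n := diag_mx (\row_i (i \in T)%:R).

Lemma proj_onE T i j : proj_on T i j = ((i == j) && (i \in T))%:R.
Proof. by rewrite !mxE; case: eqP => //= ->. Qed.

Lemma mul_proj_on m (A : 'M_(m, n)) T i j :
  (A *m proj_on T) i j = A i j * (j \in T)%:R.
Proof. by rewrite mul_mx_diag !mxE. Qed.

Lemma proj_on_mul m (A : 'M_(n, m)) T i j :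
  (proj_on T *m A) i j = (i \in T)%:R * A i j.
Proof. by rewrite mul_diag_mx !mxE. Qed.

Lemma proj_on_sub S T : S \subset T -> proj_on S *m proj_on T = proj_on S.
Proof.
move=> sST; apply/matrixP=> i j; rewrite mul_proj_on proj_onE.
case: eqP => [<-|]; last by rewrite mul0r.
by have [/(subsetP sST)->|] := boolP (i \in S); rewrite ?mul1r ?mul0r.
Qed.

Lemma rank_proj_on T : \rank (proj_on T) = #|T|.
Proof.
(* the rows of J are the basis vectors indexed by T *)
have [J JE] : exists J : 'M[F]_(#|T|, n),
    forall i j, J i j = (j == enum_val i)%:R.
  by exists (\matrix_(i, j) (j == enum_val i)%:R) => i j; rewrite mxE.
have JtE i j : J^T i j = (i == enum_val j)%:R by rewrite mxE JE.
have JJ1 : J *m J^T = 1%:M.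
  apply/matrixP=> i j; rewrite !mxE (bigD1 (enum_val i)) //= big1 => [|k ki].
    by rewrite JtE JE eqxx mul1r addr0 (inj_eq enum_val_inj).
  by rewrite JE (negPf ki) mul0r.
have -> : proj_on T = J^T *m J.
  apply/matrixP=> i j; rewrite proj_onE mxE.
  have [Ti|nTi] := boolP (i \in T); last first.
    rewrite andbF big1 // => k _; rewrite JtE.
    case: eqP => [ik|]; last by rewrite mul0r.
    by rewrite ik enum_valP in nTi.
  rewrite (bigD1 (enum_rank_in Ti i)) //= big1 => [|k ki].
    by rewrite JtE JE enum_rankK_in // eqxx mul1r addr0 andbT eq_sym.
  rewrite JtE; case: eqP => [ik|]; last by rewrite mul0r.
  by case/eqP: ki; apply: enum_val_inj; rewrite enum_rankK_in.
have Jfree : row_free J by apply/row_freeP; exists J^T.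
by rewrite mxrankMfree // mxrank_tr; apply/eqP.
Qed.

End Idempotents.

(** * Information sets *)

Section ExactCard.

Variable T : finType.
Implicit Types A B : {set T}.

Lemma exact_subset A k :
  (k <= #|A|)%N -> exists2 B : {set T}, B \subset A & #|B| = k.
Proof.
move=> kA; exists [set x in take k (enum A)].
  by apply/subsetP=> x; rewrite inE -(mem_enum A); apply: mem_take.
rewrite cardsE (card_uniqP _) ?take_uniq ?enum_uniq // size_take -cardE.
by case: ltngtP kA.
Qed.

Lemma exact_superset A k :
  (#|A| <= k <= #|T|)%N -> exists2 B : {set T}, A \subset B & #|B| = k.
Proof.
case/andP=> Ak kT.
have [|B sBA cB] := @exact_subset (~: A) (#|T| - k).
  by rewrite cardsCs setCK leq_sub2l.
exists (~: B); first by rewrite -setCS setCK.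
by rewrite cardsCs setCK cB subKn.
Qed.

End ExactCard.

Section InformationSets.

Variables (F : fieldType) (n k : nat) (E : 'M[F]_n).
Hypothesis rankE : \rank E = k.
Hypothesis infoE : forall T : {set _}, #|T| = k -> \rank (E *m proj_on F T) = k.

(** A word of the code that vanishes on a set containing k coordinates is 0, so
    restriction to such a set is injective on the code. *)
Lemma info_set_sup (T : {set _}) m (A : 'M_(m, n)) :
  (k <= #|T|)%N -> (A <= E)%MS -> \rank (A *m proj_on F T) = \rank A.
Proof.
case/exact_subset=> T1 sT1 /infoE rT1 sAE; apply/mxrank_injP.
suff /eqP E0 : (E :&: kermx (proj_on F T))%MS == 0.
  by rewrite -submx0 -E0 capmxS.
apply/mxrank_injP/eqP; rewrite eqn_leq mxrankM_maxl rankE -rT1 /=.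
rewrite -(proj_on_sub F sT1) [proj_on F T1 *m _]diag_mxC mulmxA.
exact: mxrankM_maxl.
Qed.

(** The code takes arbitrary values on k coordinates by a dimension count, hence
    also on any smaller set of coordinates. *)
Lemma info_set_sub (T : {set _}) :
  (#|T| <= k)%N -> (proj_on F T <= E *m proj_on F T)%MS.
Proof.
move=> Tk; have [|T1 sT cT1] := @exact_superset _ T k.
  by rewrite Tk card_ord -rankE rank_leq_row.
have s1 : (proj_on F T1 <= E *m proj_on F T1)%MS.
  rewrite -(geq_leqif (mxrank_leqif_sup (submxMl _ _))).
  by rewrite infoE // rank_proj_on cT1.
have -> : proj_on F T = proj_on F T1 *m proj_on F T.
  by rewrite [RHS]diag_mxC proj_on_sub.
by rewrite mulmxA submxMr.
Qed.

End InformationSets.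

(** * The right regular representation *)

Section Regular.

Variables (F : fieldType) (gT : finGroupType).
Local Notation G := [set: gT]%G.
Local Notation nG := (gcard G).
Local Notation aG := (regular_repr F G).
Local Notation idx := (gring_index G).
Implicit Types (x y : gT) (Q M : {group gT}) (i j : 'I_nG).

Lemma idxK x : enum_val (idx x) = x.
Proof. exact: gring_indexK (in_setT x). Qed.

Lemma aGE x i j : aG x i j = (enum_val j == enum_val i * x)%g%:R.
Proof. by rewrite !mxE eqxx /= -(inj_eq enum_val_inj) idxK. Qed.

Lemma aGM x y : aG (x * y)%g = aG x *m aG y.
Proof. by rewrite repr_mxM ?in_setT. Qed.

Lemma aG_mulE m (A : 'M_(m, nG)) x (i : 'I_m) j :
  (A *m aG x) i j = A i (idx (enum_val j * x^-1)%g).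
Proof.
rewrite mxE (bigD1 (idx (enum_val j * x^-1)%g)) //= big1 => [|l ne].
  by rewrite aGE idxK mulgKV eqxx mulr1 addr0.
rewrite aGE; case: eqP => [jl|]; last by rewrite mulr0.
by rewrite jl mulgK gring_valK eqxx in ne.
Qed.

Lemma mul_aGE m (A : 'M_(nG, m)) x i (j : 'I_m) :
  (aG x *m A) i j = A (idx (enum_val i * x)%g) j.
Proof.
rewrite mxE (bigD1 (idx (enum_val i * x)%g)) //= big1 => [|l ne].
  by rewrite aGE idxK eqxx mul1r addr0.
rewrite aGE; case: eqP => [jl|]; last by rewrite mul0r.
by rewrite -jl gring_valK eqxx in ne.
Qed.

Lemma aG_tr x : (aG x)^T = aG x^-1%g.
Proof.
apply/matrixP=> i j; rewrite [LHS]mxE !aGE.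
by rewrite -[in RHS](inj_eq (mulIg x)) mulgKV eq_sym.
Qed.

(** * Left cosets and sums over the group *)

Definition coset_rep Q x := repr (x *: Q)%g.

Lemma coset_repP Q x y : (coset_rep Q x == coset_rep Q y) = (x^-1 * y \in Q)%g.
Proof.
rewrite /coset_rep; apply/eqP/idP => [eqr|Qxy].
  have xQ := mem_repr _ (lcoset_refl Q x).
  have yQ := mem_repr _ (lcoset_refl Q y).
  rewrite -mem_lcoset -(lcoset_eqP xQ) eqr (lcoset_eqP yQ); exact: lcoset_refl.
by congr repr; apply/esym/lcoset_eqP; rewrite mem_lcoset.
Qed.

Lemma mem_coset_rep Q x : (x^-1 * coset_rep Q x \in Q)%g.
Proof. by rewrite -mem_lcoset; apply: mem_repr (lcoset_refl Q x). Qed.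

Lemma coset_repK Q x : coset_rep Q (coset_rep Q x) = coset_rep Q x.
Proof. by apply/esym/eqP; rewrite coset_repP mem_coset_rep. Qed.

Lemma card_coset_rep Q (S : {set gT}) : {in S, forall s, coset_rep Q s = s} ->
  #|[set x | coset_rep Q x \in S]| = (#|S| * #|Q|)%N.
Proof.
move=> repS; rewrite -sum1_card (partition_big (coset_rep Q) [in S]) /=.
  rewrite -sum_nat_const; apply: eq_bigr => s Ss.
  rewrite sum1_card -[RHS](card_lcoset _ s); apply: eq_card => x.
  rewrite mem_lcoset -[_ \in Q]coset_repP (repS s Ss) eq_sym.
  rewrite [LHS]inE /= inE; case: eqP => [->|_]; last by rewrite andbF.
  by rewrite Ss.
by move=> x; rewrite inE.
Qed.

Lemma card_idx (A : {set gT}) : #|[set i : 'I_nG | enum_val i \in A]| = #|A|.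
Proof.
apply: (on_card_preimset (f := enum_val)).
by exists idx => x _; [apply: gring_valK | apply: idxK].
Qed.

(** Each left coset of Q contributes |Q| equal terms. *)
Lemma sum_coset_invariant Q (f : gT -> F) : #|Q|%:R = 0 :> F ->
  (forall x q, q \in Q -> f (x * q)%g = f x) -> \sum_x f x = 0.
Proof.
move=> Q0 fQ; rewrite (partition_big (coset_rep Q) predT) //= big1 // => s _.
have fs x : coset_rep Q x == s -> f x = f s.
  by move/eqP=> <-; rewrite -(fQ x _ (mem_coset_rep Q x)) mulKVg.
rewrite (eq_bigr (fun _ => f s)) // sumr_const.
have [-> |] := eqVneq s (coset_rep Q s); last first.
  move=> ns; rewrite eq_card0 ?mulr0n // => x; rewrite !inE.
  by apply: contraNF ns => /eqP <-; rewrite coset_repK.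
rewrite (_ : #|_| = #|Q|); first by rewrite -mulr_natr Q0 mulr0.
rewrite -(card_lcoset _ s); apply: eq_card => x.
by rewrite mem_lcoset -[RHS]coset_repP eq_sym.
Qed.

(** * Idempotents of linear characters *)

Definition lin_char Q (lam : gT -> F) :=
  lam 1%g = 1 /\ {in Q &, {morph lam : x y / (x * y)%g >-> x * y}}.

(** The idempotent of the group algebra of Q attached to lam, acting by right
    multiplication: its image in a representation of Q is the isotypic component
    of lam.  For lam = 1 it is the average over Q, whose image is the space of
    vectors fixed by Q. *)
Definition lin_idem Q (lam : gT -> F) : 'M[F]_nG :=
  #|Q|%:R^-1 *: \sum_(x in Q) lam x^-1%g *: aG x.

Lemma lin_charVM Q lam x : lin_char Q lam -> x \in Q -> lam x^-1%g * lam x = 1.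
Proof. by case=> lam1 lamM Qx; rewrite -lamM ?groupV // mulVg. Qed.

Lemma aG_lin_idem Q lam y : lin_char Q lam -> y \in Q ->
  aG y *m lin_idem Q lam = lam y *: lin_idem Q lam.
Proof.
case=> lam1 lamM Qy; rewrite -scalemxAr scalerA mulrC -scalerA; congr (_ *: _).
rewrite mulmx_sumr scaler_sumr (reindex_inj (mulgI y^-1%g)) /=.
apply: eq_big => [x|x]; first by rewrite groupMl ?groupV.
rewrite groupMl ?groupV // => Qx.
by rewrite invMg invgK lamM ?groupV // -scalemxAr -aGM mulKVg scalerA mulrC.
Qed.

Lemma lin_idem_aG Q lam y : lin_char Q lam -> y \in Q ->
  lin_idem Q lam *m aG y = lam y *: lin_idem Q lam.
Proof.
case=> lam1 lamM Qy; rewrite -scalemxAl scalerA mulrC -scalerA; congr (_ *: _).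
rewrite mulmx_suml scaler_sumr (reindex_inj (mulIg y^-1%g)) /=.
apply: eq_big => [x|x]; first by rewrite groupMr ?groupV.
rewrite groupMr ?groupV // => Qx.
by rewrite invMg invgK lamM ?groupV // -scalemxAl -aGM mulgKV scalerA.
Qed.

Lemma lin_idemM Q lam : lin_char Q lam -> #|Q|%:R != 0 :> F ->
  lin_idem Q lam *m lin_idem Q lam = lin_idem Q lam.
Proof.
move=> lamQ Q0; rewrite {1}/lin_idem -scalemxAl mulmx_suml.
rewrite (eq_bigr (fun=> lin_idem Q lam)) => [|x Qx].
  by rewrite sumr_const -scaler_nat scalerA mulVf // scale1r.
by rewrite -scalemxAl aG_lin_idem // scalerA (lin_charVM lamQ) // scale1r.
Qed.

(** Inserting y between the two idempotents multiplies the product by lam y when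
    it is absorbed on the left, and by mu y when it is absorbed on the right. *)
Lemma lin_idem_orth Q lam mu y : lin_char Q lam -> lin_char Q mu ->
  y \in Q -> lam y != mu y -> lin_idem Q lam *m lin_idem Q mu = 0.
Proof.
move=> lamQ muQ Qy; apply: contraNeq => e0.
have := mulmxA (lin_idem Q lam) (aG y) (lin_idem Q mu).
rewrite aG_lin_idem // lin_idem_aG // -scalemxAl -scalemxAr.
move/eqP; rewrite -subr_eq0 -scalerBl scaler_eq0 (negPf e0) orbF subr_eq0.
by rewrite eq_sym.
Qed.

Lemma lin_idem_comm Q lam (A : 'M_nG) :
    (forall x, x \in Q -> A *m aG x = aG x *m A) ->
  A *m lin_idem Q lam = lin_idem Q lam *m A.
Proof.
move=> cA; rewrite -scalemxAl -scalemxAr mulmx_suml mulmx_sumr; congr (_ *: _).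
by apply: eq_bigr => x Qx; rewrite -scalemxAl -scalemxAr cA.
Qed.

Lemma lin_idemE Q lam i j : let x := ((enum_val i)^-1 * enum_val j)%g in
  lin_idem Q lam i j = #|Q|%:R^-1 * (if x \in Q then lam x^-1%g else 0).
Proof.
move=> x; rewrite mxE summxE; congr (_ * _).
rewrite (eq_bigr (fun y => if y == x then lam x^-1%g else 0)) => [|y Qy].
  rewrite -big_mkcondr; case: ifP => Qx.
    rewrite (big_pred1 x) // => y /=.
    by case: (y =P x) => [->|_]; rewrite ?andbF ?Qx.
  rewrite big_pred0 // => y.
  by case: (y =P x) => [->|_]; rewrite ?andbF ?Qx.
rewrite mxE aGE -[y == x](inj_eq (mulgI (enum_val i))) mulKVg eq_sym.
by case: eqP => [xy|]; rewrite ?mulr0 ?mulr1 // /x -xy mulKg.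
Qed.

(** * The multiplicity of a linear character *)

Section RankLinIdem.
Variables (Q : {group gT}) (lam : gT -> F).
Hypotheses (lamQ : lin_char Q lam) (Q0 : #|Q|%:R != 0 :> F).
Local Notation e := (lin_idem Q lam).

Variable S : {set gT}.
Hypothesis repS : {in S, forall s, coset_rep Q s = s}.

Local Notation SI := [set i : 'I_nG | enum_val i \in S].
Local Notation TI := [set i : 'I_nG | coset_rep Q (enum_val i) \in S].

Lemma card_union_cosets : #|TI| = (#|S| * #|Q|)%N.
Proof.
by rewrite -card_coset_rep // -card_idx; apply: eq_card => i; rewrite !inE.
Qed.

(** A union of |S| left cosets of Q carries a free FQ-module of rank |S|, in
    which every linear character occurs |S| times. Concretely, right translation
    by Q only rescales the rows of e, so the rows indexed by S generate all
    those indexed by T; and they are independent, because their restriction to S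
    is a nonzero multiple of the identity. *)
Lemma rank_lin_idem_cosets : \rank (proj_on F TI *m e) = #|S|.
Proof.
apply/eqP; rewrite eqn_leq -(card_idx S) -(rank_proj_on F SI).
apply/andP; split.
  apply: leq_trans (mxrankM_maxl _ e); apply/mxrankS/row_subP => i.
  pose x := enum_val i; pose s := coset_rep Q x; pose i0 := idx s.
  have [Ti|nTi] := boolP (i \in TI); last first.
    suff -> : row i (proj_on F TI *m e) = 0 by apply: sub0mx.
    by apply/rowP=> j; rewrite mxE proj_on_mul (negPf nTi) mul0r mxE.
  have Si0 : i0 \in SI by rewrite inE idxK; rewrite inE in Ti.
  suff -> : row i (proj_on F TI *m e)
          = lam (s^-1 * x)%g *: row i0 (proj_on F SI *m e).
    by rewrite scalemx_sub ?row_sub.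
  apply/rowP=> j; rewrite [LHS]mxE proj_on_mul Ti mul1r.
  rewrite [RHS]mxE [row _ _ _ _]mxE proj_on_mul Si0 mul1r.
  have Qsx : (s^-1 * x \in Q)%g.
    by rewrite -groupV invMg invgK mem_coset_rep.
  transitivity ((lam (s^-1 * x)%g *: e) i0 j); last by rewrite mxE.
  by rewrite -(aG_lin_idem lamQ Qsx) mul_aGE idxK mulKVg gring_valK.
have sST : SI \subset TI.
  by apply/subsetP=> i; rewrite !inE => Si; rewrite repS.
have SeS : proj_on F SI *m (proj_on F TI *m e) *m proj_on F SI
         = #|Q|%:R^-1 *: proj_on F SI.
  apply/matrixP=> i j; rewrite mulmxA proj_on_sub // mul_proj_on proj_on_mul.
  rewrite [RHS]mxE proj_onE lin_idemE.
  have [Si|_] := boolP (i \in SI); last by rewrite andbF !mul0r mulr0.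
  have [Sj|nSj] := boolP (j \in SI); last first.
    rewrite mulr0; case: eqP => [ij|_]; last by rewrite mulr0.
    by rewrite -ij Si in nSj.
  rewrite mul1r mulr1 andbT -coset_repP !inE in Si Sj *.
  rewrite !repS // (inj_eq enum_val_inj); case: eqP => // <-.
  by rewrite mulVg invg1 (proj1 lamQ).
apply: leq_trans (mxrankM_maxr (proj_on F SI) _).
apply: leq_trans (mxrankM_maxl _ (proj_on F SI)).
by rewrite SeS (eqmx_scale _ _) // invr_eq0.
Qed.

End RankLinIdem.

Section RankBounds.
Variables (k : nat) (E : 'M[F]_nG).
Hypothesis rankE : \rank E = k.
Hypothesis infoE : forall T : {set _}, #|T| = k -> \rank (E *m proj_on F T) = k.
Hypothesis commE : forall x, E *m aG x = aG x *m E.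
Variables (Q : {group gT}) (lam : gT -> F).
Hypotheses (lamQ : lin_char Q lam) (Q0 : #|Q|%:R != 0 :> F).
Local Notation e := (lin_idem Q lam).

Lemma exact_reps t : (t * #|Q| <= #|gT|)%N ->
  exists2 S : {set gT}, {in S, forall s, coset_rep Q s = s} & #|S| = t.
Proof.
move=> tQ; have [|S sS cS] := @exact_subset _ [set x | coset_rep Q x == x] t.
  rewrite -(leq_pmul2r (cardG_gt0 Q)) -card_coset_rep; last first.
    by move=> s; rewrite inE => /eqP.
  rewrite (eq_card (B := gT)) // => x; rewrite !inE /=; apply/eqP/coset_repK.
by exists S => // s /(subsetP sS); rewrite inE => /eqP.
Qed.

Lemma cosets_lin_idem_comm (S : {set gT}) :
  let T := [set i : 'I_nG | coset_rep Q (enum_val i) \in S] in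
  proj_on F T *m e = e *m proj_on F T.
Proof.
move=> T; apply: lin_idem_comm => q Qq; apply/matrixP=> i j.
rewrite proj_on_mul mul_proj_on aGE.
case: eqP => [ij|]; last by rewrite mulr0 mul0r.
rewrite !inE ij.
rewrite (_ : coset_rep Q (_ * q)%g = coset_rep Q (enum_val i)) 1?mulrC //.
by apply/eqP; rewrite coset_repP invMg mulgKV groupV.
Qed.

(** At most k coordinates: the code surjects onto the functions on t cosets. *)
Lemma rank_lin_idem_ge t : (t * #|Q| <= #|gT|)%N ->
  (t * #|Q| <= k)%N -> (t <= \rank (E *m e))%N.
Proof.
case/exact_reps=> S repS <- tk.
rewrite -(rank_lin_idem_cosets lamQ Q0 repS).
set T := [set i | _]; apply: leq_trans (mxrankM_maxl _ (proj_on F T)).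
rewrite -mulmxA -cosets_lin_idem_comm mulmxA; apply/mxrankS/submxMr.
by apply: (info_set_sub rankE infoE); rewrite card_union_cosets.
Qed.

(** At least k coordinates: the code embeds into the functions on t cosets. *)
Lemma rank_lin_idem_le t : (t * #|Q| <= #|gT|)%N ->
  (k <= t * #|Q|)%N -> (\rank (E *m e) <= t)%N.
Proof.
case/exact_reps=> S repS <- tk.
have cEe : E *m e = e *m E by apply: lin_idem_comm => x _.
rewrite -(rank_lin_idem_cosets lamQ Q0 repS).
set T := [set i | _].
have <- : \rank (E *m e *m proj_on F T) = \rank (E *m e).
  apply: (info_set_sup rankE infoE); last by rewrite cEe submxMl.
  by rewrite card_union_cosets.
by rewrite -mulmxA -cosets_lin_idem_comm mxrankM_maxr.
Qed.

End RankBounds.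

(** * Divisibility by the characteristic *)

Section Trace.
Variables (p : nat) (charF : p \in [pchar F]).
Hypothesis pZ : (p %| #|'Z(G)%g|)%N.

Variable E : 'M[F]_nG.
Hypothesis commE : forall x, E *m aG x = aG x *m E.

(** The trace is the sum over y of the entry of E at (y, y x^-1). This entry
    does not change when y is multiplied by a central element z: E is invariant
    under simultaneous right translation of its indices, and y x^-1 z = y z
    x^-1. *)
Lemma mxtrace_comm_aG x : \tr (E *m aG x) = 0.
Proof.
have EM y i j : E (idx (enum_val i * y)%g) (idx (enum_val j * y)%g) = E i j.
  have /matrixP/(_ i (idx (enum_val j * y)%g)) := commE y.
  by rewrite aG_mulE mul_aGE idxK mulgK gring_valK.
rewrite /mxtrace (reindex idx) /=; last first.
  by exists enum_val => i _; [apply: idxK | apply: gring_valK].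
apply: (sum_coset_invariant (Q := 'Z(G)%G)).
  by apply/eqP; rewrite -(dvdn_pcharf charF).
move=> y q /centerP[_ cq]; rewrite !aG_mulE !idxK.
have := EM q (idx y) (idx (y * x^-1)%g); rewrite !idxK => <-.
congr (E _ (idx _)).
by rewrite -!mulgA cq ?inE.
Qed.

Lemma dvdn_rank_lin_idem Q lam :
    E *m E = E -> lin_char Q lam -> #|Q|%:R != 0 :> F ->
  (p %| \rank (E *m lin_idem Q lam))%N.
Proof.
move=> idE lamQ Q0; rewrite (dvdn_pcharf charF) -mxtrace_idem.
  rewrite -scalemxAr mxtraceZ mulmx_sumr raddf_sum big1 ?mulr0 // => x _ /=.
  by rewrite -scalemxAr mxtraceZ mxtrace_comm_aG mulr0.
have cEe : E *m lin_idem Q lam = lin_idem Q lam *m E by apply: lin_idem_comm.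
by rewrite {1}cEe mulmxA -[_ *m E *m E]mulmxA idE -cEe -mulmxA lin_idemM.
Qed.

End Trace.

(** * Fixed points of solvable p'-subgroups *)

Lemma lin_char1 Q : lin_char Q (fun=> 1%R).
Proof. by split=> // x y _ _; rewrite mul1r. Qed.

Lemma lin_charX Q lam m : lin_char Q lam -> lin_char Q (fun x => lam x ^+ m).
Proof.
case=> lam1 lamM; split=> [|x y Qx Qy]; first by rewrite lam1 expr1n.
by rewrite lamM // exprMn.
Qed.

(** The cyclic group Q / M of order q is sent to the powers of w; the element y
    mapped to w itself separates the powers of lam. *)
Lemma faithful_lin_char Q M q (w : F) :
    M <| Q -> prime q -> #|Q : M| = q -> q.-primitive_root w ->
  exists lam, [/\ lin_char Q lam, {in Q, forall x, lam x ^+ q = 1},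
    {in Q, forall x, (lam x == 1) = (x \in M)}
    & exists2 y, y \in Q & lam y = w].
Proof.
move=> nMQ q_pr oQM prim_w; have /andP[sMQ nMQ'] := nMQ.
have oQb : #|Q / M|%g = q by rewrite card_quotient.
have /cyclicP[xb defQb] : cyclic (Q / M)%g by rewrite prime_cyclic ?oQb.
have oxb : #[xb]%g = q by rewrite /order -defQb.
(* the value 0 is never taken on Q, where some power of xb is always found *)
pose lam y := if [pick i : 'I_q | coset M y == (xb ^+ i)%g] is Some i
  then w ^+ i else 0.
have lamE y m : coset M y = (xb ^+ m)%g -> lam y = w ^+ m.
  move=> ym; rewrite /lam; case: pickP => [i /eqP|noi].
    rewrite ym => /eqP; rewrite eq_expg_mod_order oxb => /eqP im.
    by apply/eqP; rewrite (eq_prim_root_expr prim_w) eq_sym; apply/eqP.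
  have lt_q : (m %% q < q)%N by rewrite ltn_mod prime_gt0.
  have /eqP[] := noi (Ordinal lt_q); rewrite ym /=; apply/eqP.
  by rewrite eq_expg_mod_order oxb modn_mod.
have lamP y : y \in Q -> exists m, coset M y = (xb ^+ m)%g.
  by move=> Qy; apply/cycleP; rewrite -defQb mem_quotient.
exists lam; split.
- split=> [|x y Qx Qy]; first by rewrite (@lamE _ 0) ?expr0 // morph1.
  have [[i xi] [j yj]] := (lamP x Qx, lamP y Qy).
  rewrite (lamE _ _ xi) (lamE _ _ yj) -exprD; apply: lamE.
  by rewrite coset_morphM ?(subsetP nMQ') // xi yj expgD.
- move=> x /lamP[i xi].
  by rewrite (lamE _ _ xi) exprAC (prim_expr_order prim_w) expr1n.
- move=> x Qx; have [i xi] := lamP x Qx; rewrite (lamE _ _ xi).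
  rewrite -(prim_order_dvd prim_w) -oxb order_dvdn -xi.
  by apply/eqP/idP=> [/coset_idr->|/coset_id]; rewrite ?(subsetP nMQ').
have : xb \in (Q / M)%g by rewrite defQb cycle_id.
by case/morphimP=> y _ Qy def_xb; exists y; rewrite // (@lamE y 1) // def_xb.
Qed.

(** The coefficient of x on the left is a multiple of the sum of the q powers of
    lam x^-1, a q-th root of unity: it is 0 unless this root is 1. *)
Lemma sum_lin_idem Q M q lam :
    M \subset Q -> (q * #|M|)%N = #|Q| -> #|Q|%:R != 0 :> F -> lin_char Q lam ->
    {in Q, forall x, lam x ^+ q = 1} ->
    {in Q, forall x, (lam x == 1) = (x \in M)} ->
  \sum_(j < q) lin_idem Q (fun x => lam x ^+ j) = lin_idem M (fun=> 1%R).
Proof.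
move=> sMQ oQ Q0 lamQ lamq lamM; rewrite -scaler_sumr exchange_big /=.
rewrite (eq_bigr (fun x => (if x \in M then q%:R else 0) *: aG x)); last first.
  move=> x Qx; rewrite -scaler_suml; congr (_ *: _).
  rewrite -groupV -lamM ?groupV //; case: eqP => [->|/eqP lx].
    rewrite (eq_bigr (fun=> 1%R)) ?sumr_const ?card_ord // => j _.
    by rewrite expr1n.
  have /eqP := subrX1 (lam x^-1%g) q; rewrite lamq ?groupV // subrr eq_sym.
  by rewrite mulf_eq0 subr_eq0 (negPf lx) => /eqP.
rewrite (bigID [in M]) /= [X in _ + X]big1; last first.
  by move=> x /andP[_ /negPf->]; rewrite scale0r.
rewrite addr0 scaler_sumr /lin_idem scaler_sumr; apply: eq_big => [x|x].
  by rewrite andb_idl // => /(subsetP sMQ).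
case/andP=> _ ->; rewrite scalerA scale1r; congr (_ *: _).
move: Q0; rewrite -oQ natrM mulf_eq0 negb_or => /andP[q0 M0].
by rewrite invfM mulrAC mulVf // mul1r.
Qed.

Section Tower.

Variables (p : nat) (charF : p \in [pchar F]).
Hypothesis pZ : (p %| #|'Z(G)%g|)%N.
Hypothesis rootF :
  forall q, prime q -> q != p -> exists w : F, q.-primitive_root w.

Variables (k : nat) (E : 'M[F]_nG).
Hypothesis idE : E *m E = E.
Hypothesis rankE : \rank E = k.
Hypothesis infoE : forall T : {set _}, #|T| = k -> \rank (E *m proj_on F T) = k.
Hypothesis commE : forall x, E *m aG x = aG x *m E.

(** Both ranks are multiples of p, and both are the floor or the ceiling of
    k / |Q|, which are equal or consecutive. *)
Lemma rank_lin_idem_const Q lam mu : #|Q|%:R != 0 :> F ->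
    lin_char Q lam -> lin_char Q mu ->
  \rank (E *m lin_idem Q lam) = \rank (E *m lin_idem Q mu).
Proof.
move=> Q0.
suff le l m : lin_char Q l -> lin_char Q m ->
    (\rank (E *m lin_idem Q l) <= \rank (E *m lin_idem Q m))%N.
  by move=> lamQ muQ; apply/eqP; rewrite eqn_leq !le.
move=> lQ mQ.
have kG : (k <= #|gT|)%N by rewrite -rankE -[#|gT|]cardsT rank_leq_row.
have akQ : (k %/ #|Q| * #|Q| <= k)%N by apply: leq_trunc_div.
have ge := rank_lin_idem_ge rankE infoE mQ Q0 (leq_trans akQ kG) akQ.
have [Qk|nQk] := boolP (#|Q| %| k)%N.
  apply: leq_trans ge.
  by apply: (rank_lin_idem_le rankE infoE commE lQ Q0); rewrite divnK.
(* the bound by the ceiling needs that many cosets to exist: |Q| divides n *)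
have lt_k : (k < (k %/ #|Q|).+1 * #|Q|)%N by rewrite ltn_ceil ?cardG_gt0.
have lt_G : ((k %/ #|Q|).+1 * #|Q| <= #|gT|)%N.
  have /dvdnP[N defG] : (#|Q| %| #|gT|)%N by rewrite -cardsT cardSg ?subsetT.
  have : (k %/ #|Q| * #|Q| < N * #|Q|)%N.
    rewrite -defG (leq_trans _ kG) // ltn_neqAle akQ andbT.
    by apply: contraNneq nQk => <-; apply: dvdn_mull.
  by rewrite defG !leq_pmul2r ?cardG_gt0 // ltn_pmul2r ?cardG_gt0.
have le := rank_lin_idem_le rankE infoE commE lQ Q0 lt_G (ltnW lt_k).
rewrite leqNgt; apply/negP => lt_ml.
have p_l := dvdn_rank_lin_idem charF pZ commE idE lQ Q0.
have p_m := dvdn_rank_lin_idem charF pZ commE idE mQ Q0.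
have := dvdn_sub p_l p_m.
rewrite (_ : (_ - _)%N = 1%N); last by lia.
by rewrite dvdn1; move/eqP=> p1; have := pcharf_prime charF; rewrite p1.
Qed.

(** Induction on |Q|: let M be normal of prime index q in Q. The fixed points of
    M are the direct sum of the components of the q powers of a character of Q
    with kernel M, and these have equal ranks, so the fixed points of Q, the
    component of the trivial power, have a rank q times smaller. *)
Lemma rank_fixed_mul Q : solvable Q -> ~~ (p %| #|Q|)%N ->
  (\rank (E *m lin_idem Q (fun=> 1%R)) * #|Q|)%N = k.
Proof.
have [m] := ubnP #|Q|; elim: m Q => // m IHm Q leQm solQ p'Q.
have Q0 : #|Q|%:R != 0 :> F by rewrite -(dvdn_pcharf charF).
have [Q1|ntQ] := eqVneq (Q : {set gT}) 1%g.
  rewrite /lin_idem Q1 big_set1 cards1 invr1 !scale1r.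
  by rewrite repr_mx1 mulmx1 muln1.
have [M nMQ q_pr] := sol_prime_factor_exists solQ ntQ.
have sMQ := normal_sub nMQ.
set q := #|Q : M|%g in q_pr; have oQ : (q * #|M|)%N = #|Q|.
  by rewrite mulnC Lagrange.
have qp : q != p.
  by apply: contraNneq p'Q => <-; rewrite -oQ dvdn_mulr.
have [w prim_w] := rootF q_pr qp.
have [lam [lamQ lamq lamM [y Qy lam_y]]] :=
  faithful_lin_char nMQ q_pr erefl prim_w.
have <- : (\rank (E *m lin_idem M (fun=> 1%R)) * #|M|)%N = k.
  apply: IHm; rewrite ?(solvableS sMQ) //.
    rewrite -ltnS (leq_ltn_trans _ leQm) // -oQ.
    by rewrite ltn_Pmull ?prime_gt1 ?cardG_gt0.
  by apply: contra p'Q => /dvdn_trans-> //; rewrite -oQ dvdn_mull.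
rewrite -oQ mulnA; congr (_ * _)%N.
rewrite -(sum_lin_idem sMQ oQ Q0 lamQ lamq lamM) mulmx_sumr.
have lamX (j : nat) := lin_charX j lamQ.
have commI l : E *m lin_idem Q l = lin_idem Q l *m E by apply: lin_idem_comm.
rewrite mxrank_idem_sum.
- rewrite (eq_bigr (fun=> \rank (E *m lin_idem Q (fun=> 1%R)))).
    by rewrite sum_nat_const card_ord mulnC.
  by move=> j _; apply: rank_lin_idem_const (lin_char1 Q).
- move=> j; rewrite {1}commI mulmxA -[_ *m E *m E]mulmxA idE -commI -mulmxA.
  by rewrite lin_idemM.
move=> i j ij; rewrite {1}commI mulmxA -[_ *m E *m E]mulmxA idE -commI -mulmxA.
rewrite (lin_idem_orth (lamX i) (lamX j) Qy) ?mulmx0 // lam_y.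
by rewrite (eq_prim_root_expr prim_w) !modn_small ?ltn_ord.
Qed.

End Tower.

(** * Vectors fixed by the whole group *)

Section FixedVector.

Variables (p : nat) (charF : p \in [pchar F]) (nilG : nilpotent G).
Local Notation P := ('O_p(G))%G.
Local Notation H := ('O_p^'(G))%G.
Local Notation e := (lin_idem H (fun=> 1%R)).
Local Notation u := (gring_row (gset_mx F G G)).

(** Here u is the constant vector 1. The image U of A e consists of vectors
    fixed by the p-complement H and is stable under G, so the Sylow p-subgroup P
    acts on it and, as a p-group in characteristic p, fixes some nonzero vector
    of U. Such a vector is fixed by G = P H, hence is a multiple of u. *)
Lemma ones_sub_idem (A : 'M[F]_nG) :
    (forall x, A *m aG x = aG x *m A) -> A *m e != 0 ->
  u != 0 /\ (u <= A)%MS.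
Proof.
move=> commA nzAe; pose U := A *m e.
have [_ defG cPH _] := dprodP (nilpotent_pcoreC p nilG).
have eK h : h \in H -> e *m aG h = e /\ aG h *m e = e.
  by move=> Hh; rewrite lin_idem_aG ?aG_lin_idem ?scale1r //; apply: lin_char1.
have comme x : aG x *m e = e *m aG x.
  have : x \in ('O_p(G) * 'O_p^'(G))%g by rewrite defG inE.
  case/mulsgP=> a b Pa Hb ->; rewrite aGM -mulmxA (proj2 (eK b Hb)) mulmxA.
  have caH : aG a *m e = e *m aG a.
    apply: lin_idem_comm => h Hh; rewrite -!aGM; congr (aG _).
    by apply/esym/(centsP cPH).
  by rewrite -caH -mulmxA (proj1 (eK b Hb)).
have UA : (U <= A)%MS.
  rewrite /U (_ : A *m e = e *m A) ?submxMl //.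
  by apply: lin_idem_comm => h _.
have modU : mxmodule aG U.
  apply/mxmoduleP=> x _; rewrite /U -mulmxA -comme mulmxA commA -mulmxA.
  exact: submxMl.
pose W := (U :&: rfix_mx aG P)%MS.
have nzW : W != 0.
  have : rfix_mx (submod_repr modU) P != 0.
    apply: (rfix_pgroup_pchar charF); rewrite ?pcore_pgroup ?pcore_sub //.
    by rewrite lt0n mxrank_eq0.
  apply: contraNneq => W0; rewrite -submx0 rfix_submod ?pcore_sub //.
  by move: W0; rewrite /W => ->; rewrite linear0 sub0mx.
have sWu : (W <= u)%MS.
  rewrite -rfix_regular; apply/rfix_mxP=> x _.
  have : x \in ('O_p(G) * 'O_p^'(G))%g by rewrite defG inE.
  case/mulsgP=> a b Pa Hb ->; rewrite aGM mulmxA.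
  have -> : W *m aG a = W by apply: (rfix_mxP P); rewrite ?capmxSr.
  have /submxP[B ->] : (W <= U)%MS by apply: capmxSl.
  by rewrite /U -!mulmxA (proj1 (eK b Hb)).
have nzu : u != 0.
  apply: contraNneq nzW => u0; rewrite -submx0.
  by apply: submx_trans sWu _; rewrite u0 sub0mx.
split=> //; apply: submx_trans (submx_trans (capmxSl U (rfix_mx aG P)) UA).
rewrite -(geq_leqif (mxrank_leqif_sup sWu)).
by rewrite (leq_trans (rank_leq_row u)) // lt0n mxrank_eq0.
Qed.

End FixedVector.

(** By [rank_fixed_mul], applied to E and to the identity matrix, E e has rank
    k / |H| and e has rank n / |H|; as 0 < k < n, neither E e nor (1 - E) e
    vanishes.  By [ones_sub_idem] the constant vectors are then in the images of
    both complementary projections E and 1 - E. *)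
Theorem no_mds_idempotent p k (E : 'M[F]_nG) :
    p \in [pchar F] -> nilpotent G -> (p %| #|gT|)%N ->
    (forall q, prime q -> q != p -> exists w : F, q.-primitive_root w) ->
    E *m E = E -> \rank E = k -> (0 < k < #|gT|)%N ->
    (forall T : {set _}, #|T| = k -> \rank (E *m proj_on F T) = k) ->
    ~ (forall x, E *m aG x = aG x *m E).
Proof.
move=> charF nilG pG rootF idE rankE /andP[k_gt0 ltkG] infoE commE.
have p_pr := pcharf_prime charF.
have pZ : (p %| #|'Z(G)|)%N.
  have ntP : 'O_p(G) != 1%g.
    rewrite -cardG_gt1 (card_Hall (nilpotent_pcore_Hall p nilG)) p_part cardsT.
    rewrite (ltn_exp2l 0 _ (prime_gt1 p_pr)) logn_gt0 mem_primes p_pr pG andbT.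
    by rewrite -cardsT cardG_gt0.
  have := meet_center_nil nilG (pcore_normal p G) ntP.
  have /pgroup_pdiv pP : p.-group ('O_p(G) :&: 'Z(G)).
    by apply: pgroupS (subsetIl _ _) (pcore_pgroup p G).
  by case/pP=> _ pI _; apply: dvdn_trans pI (cardSg (subsetIr _ _)).
set H := ('O_p^'(G))%G; pose e := lin_idem H (fun=> 1%R).
have solH : solvable H by rewrite (solvableS (subsetT _)) ?nilpotent_sol.
have p'H : ~~ (p %| #|H|)%N by rewrite -p'natE // -/(pgroup _ _) pcore_pgroup.
have rk := rank_fixed_mul charF pZ rootF idE rankE infoE commE solH p'H.
(* the identity matrix is the projection onto the code FG, which is also MDS *)
have rk1 : (\rank e * #|H|)%N = nG.
  rewrite -[e]mul1mx; apply: (rank_fixed_mul charF pZ rootF) => //.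
  - by rewrite mulmx1.
  - exact: mxrank1.
  - by move=> T cT; rewrite mul1mx rank_proj_on.
  - by move=> x; rewrite mulmx1 mul1mx.
have [|nzu /submxP[a ua]] := @ones_sub_idem _ charF nilG E commE.
  by rewrite -mxrank_eq0; apply: contraTneq k_gt0 => E0; rewrite -rk E0.
have [|| _ /submxP[b ub]] := @ones_sub_idem _ charF nilG (1%:M - E).
- by move=> x; rewrite mulmxBl mulmxBr mul1mx mulmx1 commE.
- rewrite mulmxBl mul1mx subr_eq0; apply: contraTneq ltkG => eE.
  by rewrite -rk -eE rk1 /gcard cardsT ltnn.
case/eqP: nzu; rewrite ua -idE mulmxA -ua ub -mulmxA mulmxBl mul1mx idE subrr.
by rewrite mulmx0.
Qed.

End Regular.

(** * Roots of unity and nilpotence *)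

(** A root of 1 + X + ... + X^(q-1) is a q-th root of unity, and is not 1
    because the value at 1 is q. *)
Lemma closed_field_prim_root (L : closedFieldType) q :
  prime q -> q%:R != 0 :> L -> exists w : L, q.-primitive_root w.
Proof.
move=> q_pr q0; have q_gt0 := prime_gt0 q_pr.
pose f : {poly L} := \poly_(i < q) 1.
have /closed_rootP[w /rootP fw] : size f != 1%N.
  by rewrite size_poly_eq ?oner_eq0 // gtn_eqF ?prime_gt1.
have fwE : \sum_(i < q) w ^+ i = 0.
  by rewrite -[RHS]fw horner_poly; apply: eq_bigr => i _; rewrite mul1r.
have wq : w ^+ q = 1 by apply/eqP; rewrite -subr_eq0 subrX1 fwE mulr0.
have w1 : w != 1.
  apply: contraNneq q0 => w1.
  rewrite -[X in _ == X]fwE w1 (eq_bigr (fun=> 1)) => [|i _].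
    by rewrite sumr_const card_ord.
  by rewrite expr1n.
have [m prim_w m_dv_q] := prim_order_exists q_gt0 wq; exists w.
case/primeP: q_pr => _ /(_ m m_dv_q)/orP[]/eqP mE; last by rewrite -mE.
by case/eqP: w1; rewrite -(prim_expr_order prim_w) mE expr1.
Qed.

(** A unique Sylow subgroup is normal and nilpotent, hence contained in the
    Fitting subgroup, whose order is then divisible by every primary part of
    |G|. *)
Lemma nilpotent_normal_sylow (gT : finGroupType) (G : {group gT}) :
  (forall q, prime q -> (q %| #|G|)%N -> #|'Syl_q(G)| = 1%N) -> nilpotent G.
Proof.
move=> syl1; suff <- : 'F(G) = G by apply: Fitting_nil.
apply/eqP; rewrite eqEcard Fitting_sub dvdn_leq ?cardG_gt0 //.
apply/dvdn_partP=> // q; rewrite mem_primes => /and3P[q_pr _ qG].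
have /eqP/normal_sylowP[P sylP nPG] := syl1 q q_pr qG.
rewrite -(card_Hall sylP) cardSg // Fitting_max //.
exact: pgroup_nil (pHall_pgroup sylP).
Qed.

(** * The orthogonal projection onto an LCD code *)

Section CodeMatrix.

Variables (K : fieldType) (gT : finGroupType).
Local Notation G := [set: gT]%G.
Local Notation nG := (gcard G).
Local Notation aG := (regular_repr K G).
Local Notation KG := (group_algebra K gT).
Implicit Types a b : KG.

Definition word a : 'rV[K]_nG := \row_i coef a (enum_val i).

Lemma word_is_linear : linear word.
Proof. by move=> c a b; apply/rowP=> i; rewrite !mxE Defs.coefD Defs.coefZ. Qed.

HB.instance Definition _ :=
  GRing.isLinear.Build K KG 'rV[K]_nG _ word word_is_linear.

Lemma word_inj : injective word.
Proof.
move=> a b ab; apply/ga_eqP=> g; have /rowP/(_ (gring_index G g)) := ab.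
by rewrite !mxE idxK.
Qed.

Lemma word_mul_elem a x : word (a * ga_elem K x) = word a *m aG x.
Proof.
apply/rowP=> j; rewrite aG_mulE !mxE idxK coef_mul.
rewrite (bigD1 (enum_val j * x^-1)%g) //= big1 => [|h ne].
  by rewrite coef_elem invMg invgK mulgKV eqxx mulr1 addr0.
rewrite coef_elem; case: eqP => [hx|]; last by rewrite mulr0.
by case/eqP: ne; rewrite -hx invMg invgK mulKVg.
Qed.

Lemma word_inner a b : inner a b = (word a *m (word b)^T) 0 0.
Proof.
rewrite mxE /inner (reindex (enum_val : 'I_nG -> gT)) /=; last first.
  by exists (gring_index G) => i _; [apply: gring_valK | apply: idxK].
by apply: eq_bigr => i _; rewrite !mxE.
Qed.

Variable C : {vspace KG}.
Hypotheses (C_code : group_code C) (C_LCD : LCD C) (C_MDS : MDS C).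

Local Notation k := (\dim C).
Local Notation A := (\matrix_(i < k) word (vbasis C)`_i).

Definition gen_word (v : 'rV[K]_k) : KG := \sum_i v 0 i *: (vbasis C)`_i.

Lemma word_gen_word v : word (gen_word v) = v *m A.
Proof.
rewrite mulmx_sum_row linear_sum; apply: eq_bigr => i _.
by rewrite linearZ rowK.
Qed.

Lemma gen_word_mem v : gen_word v \in C.
Proof.
by apply: memv_suml => i _; rewrite memvZ // vbasis_mem // mem_nth ?size_tuple.
Qed.

Lemma gen_word_surj a : a \in C -> exists v, a = gen_word v.
Proof.
move=> /coord_vbasis->; exists (\row_i coord (vbasis C) i a).
by apply: eq_bigr => i _; rewrite mxE.
Qed.

Lemma gen_word_eq0 v : gen_word v = 0 -> v = 0.
Proof.
have /freeP fr := basis_free (vbasisP C).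
by move/fr=> v0; apply/rowP=> i; rewrite v0 mxE.
Qed.

(** A vector in the kernel of the Gram matrix yields a word of C orthogonal to
    C, which is 0 as C is LCD. *)
Lemma gram_unit : A *m A^T \in unitmx.
Proof.
rewrite -row_free_unit; apply: inj_row_free => v; rewrite mulmxA => vAA.
apply: gen_word_eq0; apply/C_LCD; split=> [|a /gen_word_surj[w ->]].
  exact: gen_word_mem.
rewrite word_inner !word_gen_word -[w *m A *m _]trmxK trmx_mul trmxK.
by rewrite (trmx_mul w) mulmxA vAA mul0mx trmx0 mxE.
Qed.

(** The classical formula for the orthogonal projection onto the row space of
    A. *)
Definition code_proj : 'M[K]_nG := A^T *m invmx (A *m A^T) *m A.
Local Notation E := code_proj.

Lemma gen_mx_proj : A *m E = A.
Proof. by rewrite /code_proj !mulmxA mulmxV ?gram_unit // mul1mx. Qed.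

Lemma code_proj_sub : (E <= A)%MS. Proof. exact: submxMl. Qed.

Lemma eq_code_proj : (E :=: A)%MS.
Proof.
by apply/eqmxP; rewrite code_proj_sub -{1}gen_mx_proj submxMl.
Qed.

Lemma sub_gen_mx_proj m (B : 'M_(m, nG)) : (B <= A)%MS -> B *m E = B.
Proof. by case/submxP=> D ->; rewrite -mulmxA gen_mx_proj. Qed.

Lemma code_proj_idem : E *m E = E.
Proof. exact: sub_gen_mx_proj code_proj_sub. Qed.

Lemma code_proj_tr : E^T = E.
Proof. by rewrite /code_proj !trmx_mul trmx_inv !trmx_mul !trmxK mulmxA. Qed.

(** As C is a right ideal, E R = E R E for every right multiplication R. Since E
    is symmetric and the transpose of R is the right multiplication by the
    inverse, transposing gives R E = E R E as well. *)
Lemma code_proj_comm x : E *m aG x = aG x *m E.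
Proof.
have EaE y : E *m aG y *m E = E *m aG y.
  apply: sub_gen_mx_proj.
  apply: submx_trans (submxMr _ code_proj_sub) _; apply/row_subP=> i.
  rewrite row_mul rowK -word_mul_elem.
  have [|v ->] := @gen_word_surj ((vbasis C)`_i * ga_elem K y).
    by apply: C_code; rewrite vbasis_mem // mem_nth ?size_tuple.
  by rewrite word_gen_word submxMl.
rewrite -EaE; apply: trmx_inj.
rewrite [LHS]trmx_mul [(E *m aG x)^T]trmx_mul [RHS]trmx_mul.
by rewrite code_proj_tr aG_tr mulmxA EaE.
Qed.

Lemma rank_gen_mx : \rank A = k.
Proof.
apply/eqP; apply: inj_row_free => v; rewrite -word_gen_word => v0.
by apply: gen_word_eq0; apply: word_inj; rewrite v0 linear0.
Qed.

Lemma rank_code_proj : \rank E = k.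
Proof. by rewrite eq_code_proj rank_gen_mx. Qed.

(** A nonzero word vanishing on k coordinates would have weight at most n - k,
    below the minimum distance n - k + 1. *)
Lemma mds_info_set (T : {set 'I_nG}) : #|T| = k -> \rank (E *m proj_on K T) = k.
Proof.
move=> cT; rewrite (eqmxMr _ eq_code_proj); apply/eqP; apply: inj_row_free => v.
rewrite mulmxA -word_gen_word => v0; apply: gen_word_eq0.
apply/eqP; apply/idPn => nz; have [_ /(_ _ (gen_word_mem v) nz)] := C_MDS.
apply/negP; rewrite -ltnNge addn1 ltnS.
have -> : (#|gT| - k = #|~: T|)%N.
  by rewrite [RHS]cardsCs setCK cT card_ord /gcard cardsT.
rewrite /wt -card_idx; apply/subset_leq_card/subsetP => i; rewrite !inE.
apply: contra => Ti; have /rowP/(_ i) := v0.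
by rewrite mul_proj_on Ti mulr1 !mxE => ->.
Qed.

Lemma mds_dim_gt0 : (0 < k)%N.
Proof.
have [[a [Ca nza _]] _] := C_MDS; rewrite lt0n dimv_eq0.
by apply: contraNneq nza => C0; rewrite C0 memv0 in Ca.
Qed.

Lemma dim_code_lt : C <> fullv -> (k < #|gT|)%N.
Proof.
move=> properC; have := rank_leq_col A; rewrite rank_gen_mx [gcard _]cardsT.
rewrite leq_eqVlt => /orP[/eqP kG|//]; case: properC.
apply/eqP; rewrite eqEsubv subvf; apply/subvP=> a _.
have /submxP[v] : (word a <= A)%MS.
  by apply: submx_full; rewrite /row_full rank_gen_mx kG /gcard cardsT.
by rewrite -word_gen_word => /word_inj->; apply: gen_word_mem.
Qed.

End CodeMatrix.

Theorem theorem10 (G : finGroupType)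
    (sylow_unique : forall q : nat, prime q -> (q %| #|G|)%N ->
       #|'Syl_q([set: G])%g| = 1%N)
    (K : finFieldType) (p : nat) (charK : p \in [pchar K]%R)
    (C : {vspace group_algebra K G})
    (C_code : group_code C) (C_proper : C <> fullv)
    (C_LCD : LCD C) (C_MDS : MDS C) :
  ~ (p %| #|G|)%N.
Proof.
move=> pG; have [L [f _]] := countable_algebraic_closure K.
have charL : p \in [pchar L] by rewrite (rmorph_pchar f).
have nilG : nilpotent [set: G]%G.
  apply: nilpotent_normal_sylow => q q_pr.
  by rewrite cardsT; apply: sylow_unique.
have fproj T : map_mx f (proj_on K T) = proj_on L T.
  by apply/matrixP=> i j; rewrite mxE !proj_onE rmorph_nat.
apply: (@no_mds_idempotent L G p (\dim C) (map_mx f (code_proj C))) => //.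
- move=> q q_pr qp; apply: closed_field_prim_root => //.
  by rewrite -(dvdn_pcharf charL) dvdn_prime2 ?(pcharf_prime charL) // eq_sym.
- by rewrite -map_mxM code_proj_idem.
- by rewrite mxrank_map rank_code_proj.
- by rewrite mds_dim_gt0 // dim_code_lt.
- by move=> T cT; rewrite -fproj -map_mxM mxrank_map mds_info_set.
by move=> x; rewrite -!(map_regular_repr f) -!map_mxM code_proj_comm.
Qed.
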